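(* Let $a$ and $b$ be integers such that $4\le b<a$. Then there exists a $2$-connected graph $G$ such that $\dim(G)=a$ and $\mathrm{edim}(G)=b$.
   Context: Graphs are finite, simple and undirected. A graph is $2$-connected if it is connected and has no cut vertex. For a connected graph $G$, $d_G(x,y)$ is the length of a shortest $x$-$y$ path. For an edge $e=xy\in E(G)$ and a vertex $v\in V(G)$, $d_G(e,v)=\min\{d_G(x,v),d_G(y,v)\}$. A set $S\subseteq V(G)$ is a metric generator for $G$ if for any two distinct vertices $x,y\in V(G)$ there is $v\in S$ with $d_G(x,v)\neq d_G(y,v)$; the metric dimension $\dim(G)$ is the minimum cardinality of a metric generator for $G$. A set $S\subseteq V(G)$ is an edge metric generator for $G$ if for any two distinct edges $e,f\in E(G)$ there is $v\in S$ with $d_G(e,v)\neq d_G(f,v)$; the edge metric dimension $\mathrm{edim}(G)$ is the minimum cardinality of an edge metric generator for $G$. *)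

(* Defs.v *)
From mathcomp Require Import all_boot.

Set Implicit Arguments.
Unset Strict Implicit.
Unset Printing Implicit Defensive.

Record sgraph := SGraph {
  vertex :> finType;
  adj : rel vertex;
  adj_sym : symmetric adj;
  adj_irr : irreflexive adj }.

Section SimpleGraph.
Variable G : sgraph.
Implicit Types (x y v : G) (e f : {set G}) (S : {set G}).

Definition connected : bool := [forall x : G, forall y : G, connect (@adj G) x y].

(* Adjacency in [G - v]. *)
Definition adj_del v : rel G := [rel x y | [&& adj x y, x != v & y != v]].

(* [v] separates two other vertices lying in the same component. *)
Definition cut_vertex v : bool :=
  [exists x : G, exists y : G,
    [&& x != v, y != v, connect (@adj G) x y & ~~ connect (adj_del v) x y]].

Definition two_connected : bool := connected && [forall v : G, ~~ cut_vertex v].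

Definition is_gpath x y (p : seq G) : bool :=
  [&& path (@adj G) x p, uniq (x :: p) & last x p == y].

(* The least [k < #|G|] for which some [x]-[y] path has [k] edges; a path has
   fewer than [#|G|] edges, so the out-of-range value [#|G|] is returned exactly
   when there is no [x]-[y] path, see [dist_path] and [dist_min]. *)
Definition dist x y : nat :=
  find (fun k => [exists p : k.-tuple G, is_gpath x y p]) (iota 0 #|G|).

Definition edges : {set {set G}} :=
  [set [set z.1; z.2] | z in [pred z : G * G | adj z.1 z.2]].

(* The initial value [#|G|] is harmless: it bounds all values of [dist], see
   [edge_distE]. *)
Definition edge_dist e v : nat := \big[minn/#|G|]_(x in e) dist x v.

Definition metric_generator S : bool :=
  [forall x : G, forall y : G,
    (x != y) ==> [exists v in S, dist x v != dist y v]].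

Definition edge_metric_generator S : bool :=
  [forall e in edges, forall f in edges,
    (e != f) ==> [exists v in S, edge_dist e v != edge_dist f v]].

(* The default value [setT] of [arg min] is a generator in both cases, see
   [metric_generatorT] and [edge_metric_generatorT]. *)
Definition metric_dim : nat :=
  #|[arg min_(S < [set: G] | metric_generator S) #|S| ]|.

Definition edge_metric_dim : nat :=
  #|[arg min_(S < [set: G] | edge_metric_generator S) #|S| ]|.

Lemma dist_le_card x y : dist x y <= #|G|.
Proof. by rewrite -[leqRHS](size_iota 0) find_size. Qed.

Lemma gpath_size x y p : is_gpath x y p -> size p < #|G|.
Proof. by case/and3P=> _ /card_uniqP sz _; rewrite -[_.+1]sz; apply: max_card. Qed.

Lemma dist_min x y p : is_gpath x y p -> dist x y <= size p.
Proof.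
move=> xyp; rewrite leqNgt; apply/negP=> lt_p.
have := before_find 0 lt_p; rewrite nth_iota ?(gpath_size xyp) // add0n.
by move/existsP; case; exists (in_tuple p).
Qed.

Lemma dist_path x y :
  connect (@adj G) x y -> exists2 p, is_gpath x y p & size p = dist x y.
Proof.
case/connectP=> q /shortenP[p xp up _] yE.
have xyp : is_gpath x y p by rewrite /is_gpath xp up yE /=.
have lt_d : dist x y < #|G| := leq_ltn_trans (dist_min xyp) (gpath_size xyp).
have : has (fun k => [exists p : k.-tuple G, is_gpath x y p]) (iota 0 #|G|).
  by rewrite has_find size_iota.
move/(nth_find 0); rewrite nth_iota // add0n => /existsP[r xyr].
by exists r; rewrite ?size_tuple.
Qed.

Lemma dist_eq0 x y : (dist x y == 0) = (x == y).
Proof.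
apply/eqP/eqP=> [d0|->]; last first.
  have yy : is_gpath y y [::] by rewrite /is_gpath /= eqxx.
  by have := dist_min yy; rewrite leqn0 => /eqP.
have cG : 0 < #|G| by apply/card_gt0P; exists x.
have : has (fun k => [exists p : k.-tuple G, is_gpath x y p]) (iota 0 #|G|).
  by rewrite has_find size_iota [find _ _]d0.
move/(nth_find 0); rewrite [find _ _]d0 nth_iota //= => /existsP[p].
by rewrite tuple0 => /and3P[_ _ /eqP].
Qed.

Lemma edgesP e :
  reflect (exists x y, adj x y /\ e = [set x; y]) (e \in edges).
Proof.
apply: (iffP imsetP) => [[[x y] /= xy ->]|[x [y [xy ->]]]]; first by exists x, y.
by exists (x, y).
Qed.

Lemma leq_edge_dist m e v :
  (m <= edge_dist e v) = (m <= #|G|) && [forall x in e, m <= dist x v].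
Proof.
rewrite /edge_dist; apply/idP/andP=> [le_m|[le_m /forall_inP le_me]]; last first.
  by elim/big_ind: _ => // i j; rewrite leq_min => -> ->.
suff /andP[-> /allP le_me]: (m <= #|G|) &&
    all (fun x => (x \in e) ==> (m <= dist x v)) (index_enum G).
  by split=> //; apply/forallP=> x; apply: le_me; rewrite mem_index_enum.
elim: (index_enum G) le_m => [|x s IHs]; rewrite ?big_nil ?big_cons /= ?andbT //.
case: ifP => _ /=; last exact: IHs.
by rewrite leq_min => /andP[-> /IHs].
Qed.

Lemma edge_distE x y v : edge_dist [set x; y] v = minn (dist x v) (dist y v).
Proof.
suff le_eq m : (m <= edge_dist [set x; y] v) = (m <= minn (dist x v) (dist y v)).
  by apply/eqP; rewrite eqn_leq -le_eq leqnn le_eq leqnn.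
rewrite leq_edge_dist leq_min; apply/andP/andP=> [[_ /forall_inP le_m]|[mx my]].
  by split; apply: le_m; rewrite ?set21 ?set22.
split; first exact: leq_trans mx (dist_le_card _ _).
by apply/forall_inP=> z /set2P[] ->.
Qed.

Lemma metric_generatorT : metric_generator [set: G].
Proof.
apply/forallP=> x; apply/forallP=> y; apply/implyP=> xy.
apply/existsP; exists x; rewrite inE /=.
have /eqP-> : dist x x == 0 by rewrite dist_eq0.
by rewrite eq_sym dist_eq0 eq_sym.
Qed.

Lemma edge_metric_generatorT : edge_metric_generator [set: G].
Proof.
apply/forall_inP=> e /edgesP[x [y [xy ->]]]; apply/forall_inP=> f.
case/edgesP=> z [t [zt ->]]; apply/implyP=> ne_ef.
apply: contraNT ne_ef => /existsPn all_eq.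
have sub u : u \in [set x; y] -> u \in [set z; t].
  move=> ue; have := all_eq u; rewrite inE /= negbK !edge_distE => /eqP eq_d.
  have : minn (dist x u) (dist y u) <= 0.
    have /eqP d0 : dist u u == 0 by rewrite dist_eq0.
    by case/set2P: ue => {1}<-; rewrite geq_min d0 ?orbT.
  by rewrite eq_d geq_min !leqn0 !dist_eq0 !inE ![u == _]eq_sym.
have xNy : x != y by apply: contraTneq xy => ->; rewrite adj_irr.
rewrite eqEcard cards2 cards2 xNy; apply/andP; split.
  by apply/subsetP=> u /sub.
by case: (z != t).
Qed.

End SimpleGraph.

(* Main.v *)
Require Import Defs.
From HB Require Import structures.
From mathcomp Require Import all_boot zify.

(** A false twin class of size [t] costs [t - 1] vertices both in a metric
    generator and in an edge metric generator, since two twins are told apart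
    only by themselves, and so are the edges joining them to a common
    neighbour.  Twins therefore raise [dim] and [edim] equally, and the
    question is to find a gadget that costs one vertex for [dim] and nothing
    for [edim].

    The gadget hangs on three consecutive rim vertices [p], [z], [q] of a long
    cycle; its other vertices form a path [X], [T], [Yp], [Y], [Yq], where [X]
    is joined to [z], [Yp] to [p] and [Yq] to [q].  The distances to [p] and
    to [q] are
<<
       z (1,1)   X (2,2)   T (2,3)   Yp (1,3)   Y (2,2)   Yq (3,1)
>>
    so that [X] and [Y] have the same distance to every vertex beyond [p] and
    [q], while the nine edges have pairwise distinct pairs of distances:
<<
       p z (0,1)    z q (1,0)    z X (1,1)     X T (2,2)    T Yp (1,3)
       p Yp (0,2)   Yp Y (1,2)   Y Yq (2,1)    Yq q (2,0)
>>
    Hence every metric generator contains one of the six inner vertices of each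
    gadget ([gadget_generator]), whereas the edges of a gadget are all resolved
    by one landmark seen through [p] and one seen through [q].

    In the graph [gadget_ring m k], [m] gadgets follow one another along a rim
    of [6 * m + 10] vertices.  The landmark [A] is the rim vertex [0], the
    landmark [B] the rim vertex [3 * m + 3]; all gadgets lie on the shorter arc
    between them, so that [A] sees each gadget through its [p] and [B] through
    its [q].  The longer arc exceeds the shorter one by [4], which keeps it
    from offering short cuts and separates its vertices and edges from those of
    the gadgets.  Finally [A] receives [k + 1] twins and [B] a single one, which
    forces [k + 2] vertices into every generator.  With these [k + 2] vertices,
    among them [A] and [B], all edges are resolved, and adding the [X] of each
    gadget resolves all vertices: [edim = k + 2] and [dim = k + 2 + m].

    The lower bounds come from exhibiting disjoint blocks of vertices that every
    generator must meet ([disjoint_blocks_card], [block_disjoint]).  For the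
    upper bounds only the distances to [A] and [B] matter, because a landmark
    always separates itself from the other vertices and the edges through it
    from the other edges.  These distances are given in closed form and
    certified by [dist_charE].  The graph is [2]-connected because the rim is a
    cycle and every other vertex has two paths to the rim that meet only at
    that vertex ([exit_to_rim]). *)

Set Implicit Arguments.
Unset Strict Implicit.
Unset Printing Implicit Defensive.

(** * Distances in a connected graph *)

Section Distance.
Variable G : sgraph.
Implicit Types (x y z v w : G) (S : {set G}).

Lemma dist_walk x p : path (@adj G) x p -> dist x (last x p) <= size p.
Proof.
case/shortenP=> q xq uq sub_qp.
have xyq : is_gpath x (last x q) q by rewrite /is_gpath xq uq eqxx.
apply: leq_trans (dist_min xyq) (uniq_leq_size _ sub_qp).
by case/andP: uq.
Qed.

Lemma descent_connect (e : rel G) (f : G -> nat) r :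
    (forall x, x != r -> exists2 y, e x y & f y < f x) ->
  forall x, connect e x r.
Proof.
move=> desc x; elim: {x}_.+1 {-2}x (ltnSn (f x)) => // n IHn x fx.
case: (eqVneq x r) => [->|/desc[y xy fyx]]; first exact: connect0.
by apply: connect_trans (connect1 xy) (IHn y _); apply: leq_trans fyx _.
Qed.

Lemma dist_descent_le (f : G -> nat) r :
    (forall x, x != r -> exists2 y, adj x y & f y < f x) ->
  forall x, dist x r <= f x.
Proof.
move=> desc x.
suff [p xp [<- le_p]]: exists2 p, path (@adj G) x p & last x p = r /\ size p <= f x.
  exact: leq_trans (dist_walk xp) le_p.
elim: {x}_.+1 {-2}x (ltnSn (f x)) => // n IHn x fx.
case: (eqVneq x r) => [->|/desc[y xy fyx]]; first by exists [::].
have [|p yp [lp sp]] := IHn y; first exact: leq_trans fyx _.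
by exists (y :: p); rewrite /= ?xy ?yp //; split=> //; apply: leq_ltn_trans fyx.
Qed.

Hypothesis connG : connected G.

Let connG2 x y : connect (@adj G) x y.
Proof. by move/forallP/(_ x)/forallP: connG. Qed.

Lemma dist_adj x y w : adj x y -> dist x w <= (dist y w).+1.
Proof.
have [p /and3P[yp _ /eqP<-] <-] := dist_path (connG2 y w).
by move=> xy; apply: (@dist_walk x (y :: p)); rewrite /= xy.
Qed.

Lemma dist_step x w : x != w -> exists2 y, adj x y & dist x w = (dist y w).+1.
Proof.
have [[|y p] /and3P[/= xp _ /eqP lw] dxw] := dist_path (connG2 x w).
  by rewrite lw eqxx.
case/andP: xp => xy yp _; exists y => //; apply/eqP.
by rewrite eqn_leq dist_adj // -dxw -lw ltnS dist_walk.
Qed.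

(** A function that vanishes at [r], grows by at most one along an edge and
    strictly decreases along some edge from every vertex but [r] is the distance
    to [r]: the descending walks bound the distance from above, and along a
    shortest path the function cannot grow faster than the length. *)
Lemma dist_charE (f : G -> nat) r :
    f r = 0 -> (forall x y, adj x y -> f x <= (f y).+1) ->
    (forall x, x != r -> exists2 y, adj x y & f y < f x) ->
  forall x, dist x r = f x.
Proof.
move=> fr0 lip desc x; apply/eqP; rewrite eqn_leq dist_descent_le //=.
move dn: (dist x r) => n; elim: n x dn => [|n IHn] x dn.
  by move/eqP: dn; rewrite dist_eq0 => /eqP->; rewrite fr0.
have /dist_step[y xy] : x != r by rewrite -dist_eq0 dn.
by rewrite dn => -[/esym/IHn fy]; apply: leq_trans (lip x y xy) _.
Qed.

(** * Twins and the gadget *)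

Lemma dist_twins_le u v w :
  (forall z, adj u z = adj v z) -> w != u -> dist v w <= dist u w.
Proof.
move=> uv; rewrite eq_sym => /dist_step[y uy ->].
by apply: dist_adj; rewrite -uv.
Qed.

Lemma dist_twins u v w :
  (forall z, adj u z = adj v z) -> w != u -> w != v -> dist u w = dist v w.
Proof. by move=> uv wu wv; apply/eqP; rewrite eqn_leq !dist_twins_le. Qed.

Lemma metric_generator_pair S u v :
    metric_generator S -> u != v -> exists2 w, w \in S & dist u w != dist v w.
Proof.
by move=> /forallP/(_ u)/forallP/(_ v)/implyP gen /gen /exists_inP.
Qed.

Lemma metric_generator_twins S u v :
    (forall z, adj u z = adj v z) -> u != v -> metric_generator S ->
  (u \in S) || (v \in S).
Proof.
move=> uv neq /metric_generator_pair/(_ neq)[w wS].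
by have [<-|wu] := eqVneq w u; have [<-|wv] := eqVneq w v;
  rewrite ?wS ?orbT // (dist_twins uv) ?eqxx.
Qed.

Lemma edge_metric_generator_twins S u v c :
    (forall z, adj u z = adj v z) -> u != v -> adj u c ->
    edge_metric_generator S ->
  (u \in S) || (v \in S).
Proof.
move=> uv neq uc /forall_inP/(_ [set u; c]) gen.
have vc : adj v c by rewrite -uv.
have ue : [set u; c] \in edges G by apply/edgesP; exists u, c.
have ve : [set v; c] \in edges G by apply/edgesP; exists v, c.
have neqe : [set u; c] != [set v; c].
  apply/eqP=> /setP/(_ u); rewrite !inE eqxx (negPf neq) /=.
  by move/esym/eqP=> ucE; rewrite ucE adj_irr in uc.
have /forall_inP/(_ _ ve)/implyP/(_ neqe)/exists_inP[w wS] := gen ue.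
rewrite !edge_distE.
by have [<-|wu] := eqVneq w u; have [<-|wv] := eqVneq w v;
  rewrite ?wS ?orbT // (dist_twins uv) ?eqxx.
Qed.

Lemma edge_dist_eq0 x y v : (edge_dist [set x; y] v == 0) = (v \in [set x; y]).
Proof.
by rewrite edge_distE -leqn0 geq_min !leqn0 !dist_eq0 !inE ![v == _]eq_sym.
Qed.

(** The distance to [w] at a vertex is one plus the least distance at its
    neighbours; written with lists so that it unfolds to a linear arithmetic
    constraint. *)
Lemma dist_nbrs x s w : adj x =i s -> w != x ->
  has (fun y => dist x w == (dist y w).+1) s &&
  all (fun y => dist x w <= (dist y w).+1) s.
Proof.
move=> xs; rewrite eq_sym => /dist_step[y xy dxw]; apply/andP; split.
  by apply/hasP; exists y; rewrite -?xs ?dxw.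
by apply/allP=> z; rewrite -xs; apply: dist_adj.
Qed.

(** Any walk leaving the gadget does so through [p] or [q], and [x] and [y] are
    both at distance 2 from each; the neighbourhoods of the six inner vertices
    force both distances to be [minn (dist p w) (dist q w) + 2]. *)
Lemma gadget_dist p q z x t yp y yq w :
    adj z =i [:: p; q; x] -> adj x =i [:: z; t] -> adj t =i [:: x; yp] ->
    adj yp =i [:: p; t; y] -> adj y =i [:: yp; yq] -> adj yq =i [:: y; q] ->
    w \notin [:: z; x; t; yp; y; yq] ->
  dist x w = dist y w.
Proof.
move=> Nz Nx Nt Nyp Ny Nyq; rewrite !inE !negb_or.
case/and5P=> wz wx wt wyp /andP[wy wyq].
have:= dist_nbrs Nz wz; have:= dist_nbrs Nx wx; have:= dist_nbrs Nt wt.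
have:= dist_nbrs Nyp wyp; have:= dist_nbrs Ny wy; have:= dist_nbrs Nyq wyq.
rewrite /= !orbF !andbT; lia.
Qed.

End Distance.

(** * Walks avoiding a vertex *)

Section Deletion.
Variable G : sgraph.
Implicit Types (v x : G).

Lemma connect_del_sym v : connect_sym (adj_del v).
Proof.
apply: sym_connect_sym => x y; rewrite /adj_del /= adj_sym.
by rewrite [(x != v) && _]andbC.
Qed.

Lemma connect_del_walk v x p :
  path (@adj G) x p -> v \notin x :: p -> connect (adj_del v) x (last x p).
Proof.
elim: p x => [|y p IHp] x /=; first by rewrite connect0.
case/andP=> xy yp; rewrite inE negb_or => /andP[vx vp].
apply: connect_trans (connect1 _) (IHp y yp vp).
by rewrite /adj_del /= xy eq_sym vx; move: vp; rewrite inE negb_or eq_sym => /andP[].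
Qed.

End Deletion.

(** * From generators to dimensions *)

Section Dimension.
Variable G : sgraph.
Implicit Types S : {set G}.

Lemma metric_dimE (n : nat) :
    (forall S : {set G}, metric_generator S -> n <= #|S|) ->
    (exists2 S : {set G}, metric_generator S & #|S| <= n) ->
  metric_dim G = n.
Proof.
move=> lb [S genS leS]; rewrite /metric_dim.
case: arg_minnP => [|T genT minT]; first exact: (metric_generatorT G).
by apply/eqP; rewrite eqn_leq lb // (leq_trans (minT S genS)).
Qed.

Lemma edge_metric_dimE n :
    (forall S : {set G}, edge_metric_generator S -> n <= #|S|) ->
    (exists2 S : {set G}, edge_metric_generator S & #|S| <= n) ->
  edge_metric_dim G = n.
Proof.
move=> lb [S genS leS]; rewrite /edge_metric_dim.
case: arg_minnP => [|T genT minT]; first exact: (edge_metric_generatorT G).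
by apply/eqP; rewrite eqn_leq lb // (leq_trans (minT S genS)).
Qed.

End Dimension.

Lemma disjoint_blocks_card (I V : finType) (B : I -> {set V}) (S : {set V}) :
    (forall i j v, v \in B i -> v \in B j -> i = j) ->
    (forall i, exists2 v, v \in S & v \in B i) ->
  #|I| <= #|S|.
Proof.
move=> disj meet.
have {}meet i : exists v, (v \in S) && (v \in B i).
  by have [v vS vB] := meet i; exists v; rewrite vS.
pose h i := xchoose (meet i).
have hP i : (h i \in S) && (h i \in B i) := xchooseP (meet i).
have h_inj : injective h.
  move=> i j hij; have /andP[_ hi] := hP i; have /andP[_ hj] := hP j.
  by apply: (disj i j (h i)); rewrite // hij.
rewrite -(card_imset predT h_inj); apply/subset_leq_card/subsetP=> _ /imsetP[i _ ->].
by case/andP: (hP i).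
Qed.

(** * The graph *)

Section GadgetRing.
Variables m k : nat.

(** [TwinA] are the twins of the landmark [A], the rim vertex [0], and [TwinB]
    is the twin of the landmark [B], the rim vertex [3 * m + 3].  The gadget [i]
    hangs on the rim vertices [p = 3 * i + 2], [z = 3 * i + 3] and
    [q = 3 * i + 4].  The rim edge left free between two gadgets is necessary:
    if [q] were the [p] of the next gadget, the [Yq] of one and the [Yp] of the
    next would be at the same distances from [A] and from [B]. *)
Inductive node :=
| Rim of 'I_(6 * m + 9).+1
| X of 'I_m
| T of 'I_m
| Yp of 'I_m
| Y of 'I_m
| Yq of 'I_m
| TwinA of 'I_k.+1
| TwinB.

Definition node_code (u : node) :
    'I_(6 * m + 9).+1 + ('I_m * 'I_5 + option 'I_k.+1) :=
  match u with
  | Rim s => inl s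
  | X i => inr (inl (i, inord 0))
  | T i => inr (inl (i, inord 1))
  | Yp i => inr (inl (i, inord 2))
  | Y i => inr (inl (i, inord 3))
  | Yq i => inr (inl (i, inord 4))
  | TwinA j => inr (inr (Some j))
  | TwinB => inr (inr None)
  end.

Definition node_decode
    (c : 'I_(6 * m + 9).+1 + ('I_m * 'I_5 + option 'I_k.+1)) : node :=
  match c with
  | inl s => Rim s
  | inr (inl (i, r)) => nth TwinB [:: X i; T i; Yp i; Y i; Yq i] r
  | inr (inr (Some j)) => TwinA j
  | inr (inr None) => TwinB
  end.

Lemma node_codeK : cancel node_code node_decode.
Proof. by case=> //= i; rewrite inordK. Qed.

HB.instance Definition _ := Finite.copy node (can_type node_codeK).

(** One orientation of each edge, so that an edge has a single description. *)
Definition arc (u v : node) : bool :=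
  match u, v with
  | Rim s, Rim s' => (s.+1 == s') || (s == 6 * m + 9 :> nat) && (s' == 0 :> nat)
  | X i, Rim s => s == 3 * i + 3 :> nat
  | X i, T i' | T i, Yp i' | Yp i, Y i' | Y i, Yq i' => i == i' :> nat
  | Yp i, Rim s => s == 3 * i + 2 :> nat
  | Yq i, Rim s => s == 3 * i + 4 :> nat
  | TwinA _, Rim s => (s == 1 :> nat) || (s == 6 * m + 9 :> nat)
  | TwinB, Rim s => (s == 3 * m + 2 :> nat) || (s == 3 * m + 4 :> nat)
  | _, _ => false
  end.

Definition arcs (u v : node) : bool := arc u v || arc v u.

Lemma arcs_sym : symmetric arcs.
Proof. by move=> u v; rewrite /arcs orbC. Qed.

Lemma arcs_irr : irreflexive arcs.
Proof. by case=> [s|i|i|i|i|i|j|] //; rewrite /arcs /=; lia. Qed.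

Definition gadget_ring : sgraph := SGraph arcs_sym arcs_irr.

Definition rim (s : nat) : gadget_ring := Rim (inord s).

(* Makes the bounds of all ordinals in the context available to [lia]. *)
Ltac bounds := repeat match goal with i : ordinal _ |- _ =>
  lazymatch goal with _ : is_true (nat_of_ord i < _) |- _ => fail | _ => idtac end;
  have := ltn_ord i; intro end.

Lemma rimE (s : 'I_(6 * m + 9).+1) : Rim s = rim s.
Proof. by rewrite /rim inord_val. Qed.

Lemma rim_inj s s' : s < 6 * m + 10 -> s' < 6 * m + 10 -> rim s = rim s' -> s = s'.
Proof. by move=> lts lts' [/(congr1 val)]; rewrite /= !inordK //; lia. Qed.

(** ** The distances to the two landmarks *)

(** Closed forms of the distances to [A] and [B]: along the rim the shorter way
    round, into a gadget by way of [p] from [A] and by way of [q] from [B]. *)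
Definition distA (u : node) : nat :=
  match u with
  | Rim s => minn s (6 * m + 10 - s)
  | X i | T i | Y i => 3 * i + 4
  | Yp i => 3 * i + 3
  | Yq i => 3 * i + 5
  | TwinA _ => 2
  | TwinB => 3 * m + 3
  end.

(* The first argument of [minn] is the absolute value of [s - (3 * m + 3)]. *)
Definition distB (u : node) : nat :=
  match u with
  | Rim s => minn ((s - (3 * m + 3)) + (3 * m + 3 - s)) (9 * m + 13 - s)
  | X i | Y i => 3 * (m - i) + 1
  | T i | Yp i => 3 * (m - i) + 2
  | Yq i => 3 * (m - i)
  | TwinA _ => 3 * m + 3
  | TwinB => 2
  end.

Lemma distA_lip u v : arcs u v -> distA u <= (distA v).+1.
Proof.
by case: u => [s|i|i|i|i|i|j|]; case: v => [s'|i'|i'|i'|i'|i'|j'|] //=;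
  bounds; rewrite /arcs /=; lia.
Qed.

Lemma distB_lip u v : arcs u v -> distB u <= (distB v).+1.
Proof.
by case: u => [s|i|i|i|i|i|j|]; case: v => [s'|i'|i'|i'|i'|i'|j'|] //=;
  bounds; rewrite /arcs /=; lia.
Qed.

Lemma distA_descent u : u != rim 0 -> exists2 v, arcs u v & distA v < distA u.
Proof.
case: u => [s|i|i|i|i|i|j|] neq; bounds.
- rewrite rimE in neq; have s0 : s != 0 :> nat by apply: contraNneq neq => ->.
  case: (leqP s (3 * m + 5)) => sle.
  + exists (rim s.-1); rewrite /arcs /= inordK; lia.
  case: (eqVneq (s : nat) (6 * m + 9)) => sl.
  + exists (rim 0); rewrite /arcs /= inordK; lia.
  + exists (rim s.+1); rewrite /arcs /= inordK; lia.
- exists (rim (3 * i + 3)); rewrite /arcs /= inordK; lia.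
- exists (Yp i); rewrite /arcs /=; lia.
- exists (rim (3 * i + 2)); rewrite /arcs /= inordK; lia.
- exists (Yp i); rewrite /arcs /=; lia.
- exists (rim (3 * i + 4)); rewrite /arcs /= inordK; lia.
- exists (rim 1); rewrite /arcs /= inordK; lia.
- exists (rim (3 * m + 2)); rewrite /arcs /= inordK; lia.
Qed.

Lemma distB_descent u : u != rim (3 * m + 3) -> exists2 v, arcs u v & distB v < distB u.
Proof.
case: u => [s|i|i|i|i|i|j|] neq; bounds.
- rewrite rimE in neq; have s0 : s != 3 * m + 3 :> nat by apply: contraNneq neq => ->.
  case: (ltnP s (3 * m + 3)) => sle.
  + exists (rim s.+1); rewrite /arcs /= inordK; lia.
  case: (leqP s (6 * m + 8)) => sl.
  + exists (rim s.-1); rewrite /arcs /= inordK; lia.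
  + exists (rim 0); rewrite /arcs /= inordK; lia.
- exists (rim (3 * i + 3)); rewrite /arcs /= inordK; lia.
- exists (X i); rewrite /arcs /=; lia.
- exists (Y i); rewrite /arcs /=; lia.
- exists (Yq i); rewrite /arcs /=; lia.
- exists (rim (3 * i + 4)); rewrite /arcs /= inordK; lia.
- exists (rim 1); rewrite /arcs /= inordK; lia.
- exists (rim (3 * m + 2)); rewrite /arcs /= inordK; lia.
Qed.

(** Equality of nodes in terms of natural numbers, where [lia] can use it. *)
Definition same_node (u v : node) : bool :=
  match u, v with
  | Rim s, Rim s' => s == s' :> nat
  | X i, X i' | T i, T i' | Yp i, Yp i' | Y i, Y i' | Yq i, Yq i' => i == i' :> nat
  | TwinA j, TwinA j' => j == j' :> nat
  | TwinB, TwinB => true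
  | _, _ => false
  end.

Lemma node_eqE (u v : gadget_ring) : (u == v) = same_node u v.
Proof.
case: u => [s|i|i|i|i|i|j|]; case: v => [s'|i'|i'|i'|i'|i'|j'|] /=;
  by [apply/eqP/eqP=> [[->]|/val_inj->] | apply/negbTE/eqP | apply/eqP].
Qed.

(** ** Connectivity *)

Lemma gadget_ring_connected : connected gadget_ring.
Proof.
have to0 x : connect (@adj gadget_ring) x (rim 0).
  exact: (@descent_connect gadget_ring _ distA _ distA_descent).
apply/forallP=> x; apply/forallP=> y; apply: connect_trans (to0 x) _.
by rewrite (sym_connect_sym (@adj_sym gadget_ring)).
Qed.

Lemma connect_rim_seg (v : gadget_ring) s s' : s <= s' < 6 * m + 10 ->
    (forall r, s <= r <= s' -> v != rim r) ->
  connect (adj_del v) (rim s) (rim s').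
Proof.
case/andP=> le_ss'; rewrite -(subnKC le_ss').
elim: (s' - s) => [|d IHd] ltn avoid; first by rewrite addn0 connect0.
apply: (connect_trans (IHd _ _)) => [|r le_r|]; first lia.
  by apply: avoid; lia.
apply: connect1; rewrite /adj_del /= ![_ == v]eq_sym !avoid; try lia.
by rewrite /arcs /= !inordK; lia.
Qed.

(** If [v] lies between [s] and [s'] on the rim, one goes around the other
    way, through the edge that joins the last rim vertex to the rim vertex 0. *)
Lemma connect_rim (v : gadget_ring) s s' : s < 6 * m + 10 -> s' < 6 * m + 10 ->
  v != rim s -> v != rim s' -> connect (adj_del v) (rim s) (rim s').
Proof.
wlog le_ss' : s s' / s <= s' => [wlg lts lts' vs vs'|].
  case: (leqP s s') => [/wlg|/ltnW/wlg]; first exact.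
  by rewrite connect_del_sym; apply.
move=> lts lts' vs vs'.
have [/existsP[r /andP[/andP[ltsr ltrs'] /eqP vr]]|/existsPn none] :=
  boolP [exists r : 'I_(6 * m + 10), (s < r < s') && (v == rim r)]; last first.
  apply: connect_rim_seg => [|r /andP[ler ler']]; first by rewrite le_ss'.
  have [->|nrs] := eqVneq r s; first exact: vs.
  have [->|nrs'] := eqVneq r s'; first exact: vs'.
  have ltr : r < 6 * m + 10 by lia.
  by have := none (Ordinal ltr); rewrite negb_and /= => /orP[|//]; lia.
have away q : q < 6 * m + 10 -> q != r :> nat -> v != rim q.
  by move=> ltq; apply: contraNneq; rewrite vr => /rim_inj ->.
apply: (@connect_trans _ _ (rim 0)).
  rewrite connect_del_sym; apply: connect_rim_seg => [|q leq]; first lia.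
  by apply: away; lia.
apply: (@connect_trans _ _ (rim (6 * m + 9))).
  apply: connect1; rewrite /adj_del /= ![_ == v]eq_sym !away; try lia.
  by rewrite /arcs /= !inordK; lia.
rewrite connect_del_sym; apply: connect_rim_seg => [|q leq]; first lia.
by apply: away; lia.
Qed.

(* Applies [choose] to two walks from a vertex to the rim and checks that they
   are walks and do not share a vertex; [vu] is cleared to split on [v]. *)
Ltac exits choose v vu p1 s1 p2 s2 :=
  apply: (choose p1 s1 p2 s2);
  rewrite /= /arcs /= ?inE ?node_eqE; try (case: v {choose vu} => [?|?|?|?|?|?|?|] /=);
  rewrite ?inordK; lia.

(** Every vertex off the rim has two walks to the rim that share only their
    starting point, and [v] cannot block both. *)
Lemma exit_to_rim (u v : gadget_ring) : u != v ->
  exists s, [/\ s < 6 * m + 10, v != rim s & connect (adj_del v) u (rim s)].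
Proof.
move=> uv; have vu : v != u by rewrite eq_sym.
have choose p1 s1 p2 s2 :
    path (@adj gadget_ring) u (rcons p1 (rim s1)) -> s1 < 6 * m + 10 ->
    path (@adj gadget_ring) u (rcons p2 (rim s2)) -> s2 < 6 * m + 10 ->
    (v \in rcons p1 (rim s1) -> v \notin rcons p2 (rim s2)) ->
  exists s, [/\ s < 6 * m + 10, v != rim s & connect (adj_del v) u (rim s)].
  have use p s :
      path (@adj gadget_ring) u (rcons p (rim s)) -> s < 6 * m + 10 ->
      v \notin rcons p (rim s) ->
    exists s, [/\ s < 6 * m + 10, v != rim s & connect (adj_del v) u (rim s)].
    move=> up lts vp; exists s; split=> //.
      by apply: contraNneq vp => ->; rewrite mem_rcons mem_head.
    rewrite -(last_rcons u p (rim s)).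
    by apply: connect_del_walk; rewrite // inE negb_or vu.
  move=> path1 lt1 path2 lt2 disj.
  by case: (boolP (v \in rcons p1 (rim s1))) => [/disj|] /use; apply.
case: u {uv} vu choose => [s|i|i|i|i|i|j|] vu choose; bounds.
- by exists s; rewrite -rimE; split; [lia | | apply: connect0].
- by exits choose v vu (Nil gadget_ring) (3 * i + 3)
    [:: T i : gadget_ring; Yp i] (3 * i + 2).
- by exits choose v vu [:: X i : gadget_ring] (3 * i + 3)
    [:: Yp i : gadget_ring] (3 * i + 2).
- by exits choose v vu (Nil gadget_ring) (3 * i + 2)
    [:: Y i : gadget_ring; Yq i] (3 * i + 4).
- by exits choose v vu [:: Yp i : gadget_ring] (3 * i + 2)
    [:: Yq i : gadget_ring] (3 * i + 4).
- by exits choose v vu (Nil gadget_ring) (3 * i + 4)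
    [:: Y i : gadget_ring; Yp i] (3 * i + 2).
- by exits choose v vu (Nil gadget_ring) 1 (Nil gadget_ring) (6 * m + 9).
- by exits choose v vu (Nil gadget_ring) (3 * m + 2)
    (Nil gadget_ring) (3 * m + 4).
Qed.

Lemma gadget_ring_two_connected : two_connected gadget_ring.
Proof.
apply/andP; split; first exact: gadget_ring_connected.
apply/forallP=> v; apply/existsPn=> x; apply/existsPn=> y; apply/negP.
case/and4P=> /exit_to_rim[s [lts vs xs]] /exit_to_rim[s' [lts' vs' ys']] _ /negP[].
apply: connect_trans xs (connect_trans (connect_rim lts lts' vs vs') _).
by rewrite connect_del_sym.
Qed.

(** ** Lower bounds *)

Definition gadget (i : 'I_m) : {set gadget_ring} :=
  [set u in [:: rim (3 * i + 3); X i; T i; Yp i; Y i; Yq i]].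

Lemma gadget_generator S i : metric_generator S -> exists2 v, v \in S & v \in gadget i.
Proof.
move=> gen; have neq : (X i : gadget_ring) != Y i by rewrite node_eqE.
have [w wS dw] := metric_generator_pair gen neq; exists w => //.
apply: contraNT dw; rewrite /gadget inE => w_out; apply/eqP.
by apply: (gadget_dist gadget_ring_connected
             (p := rim (3 * i + 2)) (q := rim (3 * i + 4))) w_out;
  case=> [?|?|?|?|?|?|?|]; bounds; rewrite -[_ \in @adj _ _]/(arcs _ _) /arcs;
  rewrite !inE !node_eqE /= ?inordK; lia.
Qed.

(** What metric generators and edge metric generators have in common; the
    vertex [c] is there because twins matter for edges only through a common
    neighbour. *)
Definition hits_twins (S : {set gadget_ring}) := forall u v c : gadget_ring,
  (forall z, adj u z = adj v z) -> u != v -> adj u c -> (u \in S) || (v \in S).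

Lemma TwinA_twin j (z : gadget_ring) : @adj gadget_ring (TwinA j) z = adj (rim 0) z.
Proof. by case: z => [?|?|?|?|?|?|?|]; bounds; rewrite /= /arcs /= ?inordK; lia. Qed.

Lemma TwinB_twin (z : gadget_ring) : @adj gadget_ring TwinB z = adj (rim (3 * m + 3)) z.
Proof. by case: z => [?|?|?|?|?|?|?|]; bounds; rewrite /= /arcs /= ?inordK; lia. Qed.

Lemma TwinA_rim1 j : @adj gadget_ring (TwinA j) (rim 1).
Proof. by rewrite /= /arcs /= ?inordK; lia. Qed.

(** A number that identifies the gadget containing a vertex: the position of its
    vertex [z] on the rim. *)
Definition gadget_key (v : node) : nat :=
  match v with
  | Rim s => s
  | X i | T i | Yp i | Y i | Yq i => 3 * i + 3
  | TwinA _ | TwinB => 0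
  end.

(** A generator [S] misses at most one element of the class formed by [A] and
    its [k + 1] twins.  The blocks of this class are the singletons of the
    twins, where [A] stands in for a twin that [S] misses. *)
Definition block (S : {set gadget_ring}) (c : 'I_k.+1 + unit + 'I_m) :
    {set gadget_ring} :=
  match c with
  | inl (inl j) =>
      let u : gadget_ring := TwinA j in if u \in S then [set u] else [set rim 0]
  | inl (inr _) => [set (TwinB : gadget_ring); rim (3 * m + 3)]
  | inr i => gadget i
  end.

Lemma block_disjoint S c c' v : hits_twins S ->
  v \in block S c -> v \in block S c' -> c = c'.
Proof.
move=> twS.
have missed j j' :
    (TwinA j : gadget_ring) \notin S -> (TwinA j' : gadget_ring) \notin S -> j = j'.
  move=> jS j'S; apply/eqP; apply: contraNT jS => neq.
  have jj' z : @adj gadget_ring (TwinA j) z = adj (TwinA j' : gadget_ring) z.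
    by rewrite !TwinA_twin.
  have := twS _ _ _ jj' _ (TwinA_rim1 j).
  by rewrite (negPf j'S) orbF; apply; rewrite node_eqE.
have keyE i u : u \in gadget i -> gadget_key u = 3 * i + 3.
  rewrite /gadget !inE !node_eqE.
  by case: u => [?|?|?|?|?|?|?|] /=; bounds; rewrite ?inordK; lia.
have missedA j u : u \in block S (inl (inl j)) ->
    u = TwinA j \/ u = rim 0 /\ (TwinA j : gadget_ring) \notin S.
  by rewrite /=; case: ifPn => jS /set1P ->; [left | right].
case: c => [[j|[]]|i]; case: c' => [[j'|[]]|i'] //.
- by case/missedA=> [->|[-> jS]] /missedA[E|[E j'S]];
    [case: E => -> | case: E | case: E | rewrite (missed j j')].
- by case/missedA=> [->|[-> _]] /set2P[E|E];
    [case: E | case: E | case: E | have := rim_inj _ _ E; lia].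
- case/missedA=> [->|[-> _]] /keyE /=; bounds; rewrite ?inordK; lia.
- by move=> /set2P[] -> /missedA[E|[E _]];
    [case: E | case: E | case: E | have := rim_inj _ _ E; lia].
- case/set2P=> -> /keyE /=; bounds; rewrite ?inordK; lia.
- move=> /keyE kv /missedA[vE|[vE _]]; move: kv; bounds; rewrite vE /= ?inordK; lia.
- move=> /keyE kv /set2P[] vE; move: kv; bounds; rewrite vE /= ?inordK; lia.
- by move=> /keyE kv /keyE kv'; congr (inr _); apply: val_inj => /=; lia.
Qed.

Lemma twin_blocks_meet S (c : 'I_k.+1 + unit) : hits_twins S ->
  exists2 v, v \in S & v \in block S (inl c).
Proof.
move=> twS; case: c => [j|[]] /=.
  case: ifPn => jS; first by exists (TwinA j); rewrite ?inE.
  exists (rim 0); rewrite ?inE //.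
  have := twS _ _ _ (TwinA_twin j) _ (TwinA_rim1 j); rewrite (negPf jS); apply.
  by rewrite node_eqE.
have /orP[] : ((TwinB : gadget_ring) \in S) || (rim (3 * m + 3) \in S).
- apply: (twS _ _ (rim (3 * m + 2)) TwinB_twin); first by rewrite node_eqE.
  by rewrite /= /arcs /= inordK; lia.
- by exists TwinB; rewrite ?set21.
- by exists (rim (3 * m + 3)); rewrite ?set22.
Qed.

Lemma edge_metric_lower (S : {set gadget_ring}) : edge_metric_generator S -> k + 2 <= #|S|.
Proof.
move=> gen.
have twS : hits_twins S.
  move=> u v c uv neq uc.
  exact: (edge_metric_generator_twins gadget_ring_connected uv neq uc).
suff: #|{: 'I_k.+1 + unit}| <= #|S| by rewrite card_sum card_ord card_unit; lia.
apply: (@disjoint_blocks_card _ _ (block S \o inl)) => [c c' v vc vc'|c].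
  by have [] : inl c = inl c' :> 'I_k.+1 + unit + 'I_m := block_disjoint twS vc vc'.
exact: twin_blocks_meet.
Qed.

Lemma metric_lower (S : {set gadget_ring}) : metric_generator S -> k + m + 2 <= #|S|.
Proof.
move=> gen.
have twS : hits_twins S.
  move=> u v c uv neq _.
  exact: (metric_generator_twins gadget_ring_connected uv neq gen).
suff: #|{: 'I_k.+1 + unit + 'I_m}| <= #|S|.
  by rewrite !card_sum !card_ord card_unit; lia.
apply: (@disjoint_blocks_card _ _ (block S)) => [c c' v|[c|i]].
- exact: block_disjoint.
- exact: twin_blocks_meet.
- exact: gadget_generator.
Qed.

(** ** Upper bounds *)

Lemma distAE (u : gadget_ring) : dist u (rim 0) = distA u.
Proof.
apply: (dist_charE gadget_ring_connected) => [|x y|x]; first by rewrite /= inordK; lia.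
  exact: distA_lip.
exact: distA_descent.
Qed.

Lemma distBE (u : gadget_ring) : dist u (rim (3 * m + 3)) = distB u.
Proof.
apply: (dist_charE gadget_ring_connected) => [|x y|x]; first by rewrite /= inordK; lia.
  exact: distB_lip.
exact: distB_descent.
Qed.

(** [A] takes the place of the twin [ord0], so that the image of the first two
    summands has [k + 2] elements, and two vertices of the twin classes are left
    out, one in each class. *)
Definition landmark (c : 'I_k.+1 + unit + 'I_m) : gadget_ring :=
  match c with
  | inl (inl j) => if j == ord0 then rim 0 else TwinA j
  | inl (inr _) => rim (3 * m + 3)
  | inr i => X i
  end.

Definition edge_landmarks : {set gadget_ring} :=
  [set landmark (inl c) | c : 'I_k.+1 + unit].

Definition landmarks : {set gadget_ring} :=
  [set landmark c | c : 'I_k.+1 + unit + 'I_m].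

Definition on_rim (u : node) : bool := if u is Rim _ then true else false.

(** Let [a] and [b] be the distances of a vertex to [A] and [B].  On the arc
    with the gadgets [a + b] is [3 * m + 3]; on the longer arc of length
    [3 * m + 7], either [a + b] is that length or the shortest path to one
    landmark passes through the other.  Off the rim [a + b] lies strictly between
    the two lengths and no landmark is on the way to the other one. *)
Lemma on_rimE u : on_rim u =
  [|| distA u + distB u == 3 * m + 3, distA u + distB u == 3 * m + 7,
      distA u == distB u + (3 * m + 3) | distB u == distA u + (3 * m + 3)].
Proof. by case: u => [s|i|i|i|i|i|j|] /=; bounds; lia. Qed.

(** The distance to [A] determines a rim vertex up to the reflection of the rim
    that fixes [A], and [B] is off the axis of that reflection. *)
Lemma rim_dist_inj s s' : s < 6 * m + 10 -> s' < 6 * m + 10 ->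
  minn s (6 * m + 10 - s) = minn s' (6 * m + 10 - s') ->
  minn ((s - (3 * m + 3)) + (3 * m + 3 - s)) (9 * m + 13 - s) =
  minn ((s' - (3 * m + 3)) + (3 * m + 3 - s')) (9 * m + 13 - s') -> s = s'.
Proof.
wlog le_ss' : s s' / s <= s' => [wlg lts lts' eqA eqB|].
  by case: (leqP s s') => [|/ltnW] /wlg; [apply | move=> ->].
move=> lts lts' eqA.
have {eqA} [->//|eqs] : s = s' \/ s' = 6 * m + 10 - s.
  by move: eqA; case: (leqP s) => h; case: (leqP s') => h'; lia.
have le_s : s <= 3 * m + 5 by lia.
have -> : 3 * m + 3 - s' = 0 by lia.
have -> : 9 * m + 13 - s' = 3 * m + 3 + s by lia.
rewrite (minn_idPl _) ?addn0; last lia.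
by case: (leqP s (3 * m + 3)) => h; case: (leqP (s' - (3 * m + 3))); lia.
Qed.

(** The distances to [A] and [B] determine a vertex up to the collisions of [X]
    with [Y] in one gadget and those between twins of [A]; both are resolved
    because all the [X] and all twins but one are landmarks themselves. *)
Lemma landmarks_generate : metric_generator landmarks.
Proof.
apply/forallP=> x; apply/forallP=> y; apply/implyP; apply: contraNT => /existsPn same.
have {}same c : dist x (landmark c) = dist y (landmark c).
  by have := same (landmark c); rewrite imset_f //= negbK => /eqP.
have eqA : distA x = distA y by rewrite -!distAE; exact: (same (inl (inl ord0))).
have eqB : distB x = distB y by rewrite -!distBE; exact: (same (inl (inr tt))).
have eqX i : (x == X i) = (y == X i) by rewrite -!dist_eq0 (same (inr i)).
have eqTw j : j != ord0 -> (x == TwinA j) = (y == TwinA j).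
  by move/negPf=> j0; rewrite -!dist_eq0; have := same (inl (inl j)); rewrite /= j0 => ->.
have eqR : on_rim x = on_rim y by rewrite !on_rimE eqA eqB.
rewrite node_eqE.
case: x y eqA eqB eqX eqTw eqR {same} =>
  [s|i|i|i|i|i|j|] [s'|i'|i'|i'|i'|i'|j'|] //= eqA eqB eqX eqTw _; bounds.
- by apply/eqP; apply: rim_dist_inj eqA eqB; lia.
all: try by clear eqX eqTw; lia.
- by have := eqX i; rewrite !node_eqE /=; lia.
- by have := eqX i'; rewrite !node_eqE /=; lia.
- have [j0|/eqTw] := eqVneq j ord0; last by rewrite !node_eqE /=; lia.
  have [j'0|/eqTw] := eqVneq j' ord0; last by rewrite !node_eqE /=; lia.
  by rewrite j0 j'0.
Qed.

Lemma edge_arc (e : {set gadget_ring}) : e \in edges gadget_ring ->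
  exists u v : gadget_ring, arc u v /\ e = [set u; v].
Proof.
case/edgesP=> u [v [/orP[uv|vu] ->]]; first by exists u, v.
by exists v, u; rewrite setUC.
Qed.

(** The distances from an edge to [A] and to [B] with the minimum already
    evaluated; the values for pairs that are not arcs are arbitrary. *)
Definition edge_distA (u v : node) : nat :=
  match u, v with
  | Rim s, _ => minn s (6 * m + 9 - s)
  | X i, Rim _ | T i, _ | Yp i, Y _ => 3 * i + 3
  | Yp i, _ => 3 * i + 2
  | X i, _ | Y i, _ | Yq i, _ => 3 * i + 4
  | TwinA _, _ => 1
  | TwinB, Rim s => minn s (3 * m + 3)
  | TwinB, _ => 0
  end.

Definition edge_distB (u v : node) : nat :=
  match u, v with
  | Rim s, _ => minn ((3 * m + 2 - s) + (s - (3 * m + 3))) (9 * m + 12 - s)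
  | X i, Rim _ | Y i, _ => 3 * (m - i)
  | X i, _ | Yp i, _ => 3 * (m - i) + 1
  | T i, _ => 3 * (m - i) + 2
  | Yq i, _ => 3 * (m - i) - 1
  | TwinA _, Rim s => minn (s + (3 * m + 1)) (3 * m + 3)
  | TwinA _, _ => 0
  | TwinB, _ => 1
  end.

Lemma edge_distAE u v : arc u v -> minn (distA u) (distA v) = edge_distA u v.
Proof.
by case: u v => [s|i|i|i|i|i|j|] [s'|i'|i'|i'|i'|i'|j'|] //=; bounds; lia.
Qed.

Lemma edge_distBE u v : arc u v -> minn (distB u) (distB v) = edge_distB u v.
Proof.
by case: u v => [s|i|i|i|i|i|j|] [s'|i'|i'|i'|i'|i'|j'|] //=; bounds; lia.
Qed.

(** The analogue of [on_rimE] for edges, where both sums are smaller by one.  An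
    arc that starts on the rim is a rim edge. *)
Lemma arc_on_rimE u v : arc u v -> on_rim u =
  [|| edge_distA u v + edge_distB u v == 3 * m + 2,
      edge_distA u v + edge_distB u v == 3 * m + 6,
      edge_distA u v == edge_distB u v + (3 * m + 3)
    | edge_distB u v == edge_distA u v + (3 * m + 3)].
Proof.
by case: u v => [s|i|i|i|i|i|j|] [s'|i'|i'|i'|i'|i'|j'|] //= uv; bounds; lia.
Qed.

Lemma rim_edge_inj s s' : s < 6 * m + 10 -> s' < 6 * m + 10 ->
  minn s (6 * m + 9 - s) = minn s' (6 * m + 9 - s') ->
  minn ((3 * m + 2 - s) + (s - (3 * m + 3))) (9 * m + 12 - s) =
  minn ((3 * m + 2 - s') + (s' - (3 * m + 3))) (9 * m + 12 - s') -> s = s'.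
Proof.
wlog le_ss' : s s' / s <= s' => [wlg lts lts' eqA eqB|].
  by case: (leqP s s') => [|/ltnW] /wlg; [apply | move=> ->].
move=> lts lts' eqA.
have {eqA} [->//|eqs] : s = s' \/ s' = 6 * m + 9 - s.
  by move: eqA; case: (leqP s) => h; case: (leqP s') => h'; lia.
have le_s : s <= 3 * m + 4 by lia.
(* The edge [s] lies on the side of A that contains B, and [s'] is its mirror
   image, on the longer arc. *)
have -> : s - (3 * m + 3) = (s == 3 * m + 4) by case: eqP; lia.
have -> : 3 * m + 2 - s' = 0 by lia.
have -> : 9 * m + 12 - s' = 3 * m + 3 + s by lia.
rewrite (minn_idPl _); last by case: eqP; lia.
by rewrite add0n; case: (leqP (s' - (3 * m + 3))); case: eqP; lia.
Qed.

(** The distances to [A] and [B] determine an edge, except that the edges from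
    the twins of [A] to a common neighbour collide; these are resolved by the
    twins themselves, as all of them but one are landmarks. *)
Lemma edge_landmarks_generate : edge_metric_generator edge_landmarks.
Proof.
apply/forall_inP=> _ /edge_arc[u [v [uv ->]]].
apply/forall_inP=> _ /edge_arc[u' [v' [uv' ->]]].
apply/implyP; apply: contraNT => /existsPn same.
have {}same c : edge_dist [set u; v] (landmark (inl c)) =
                edge_dist [set u'; v'] (landmark (inl c)).
  have := same (landmark (inl c)).
  by rewrite (imset_f (landmark \o inl)) //= negbK => /eqP.
have eqA : minn (distA u) (distA v) = minn (distA u') (distA v').
  by rewrite -!distAE -!edge_distE; exact: (same (inl ord0)).
have eqB : minn (distB u) (distB v) = minn (distB u') (distB v').
  by rewrite -!distBE -!edge_distE; exact: (same (inr tt)).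
have eqTw j : j != ord0 ->
    (u == TwinA j) || (v == TwinA j) = (u' == TwinA j) || (v' == TwinA j).
  move/negPf=> j0; have := same (inl j); rewrite /= j0 => eq_d.
  have memE (a b : gadget_ring) :
      (a == TwinA j) || (b == TwinA j) = (edge_dist [set a; b] (TwinA j) == 0).
    by rewrite edge_dist_eq0 !inE ![TwinA j == _]eq_sym.
  by rewrite !memE eq_d.
suff /andP[/eqP-> /eqP->] : (u == u') && (v == v') by [].
have {}eqTw j : j != ord0 -> (u == TwinA j) = (u' == TwinA j).
  (* An arc never ends at a twin of A. *)
  by move/eqTw; case: v v' uv uv' {eqTw eqA eqB same} =>
      [?|?|?|?|?|?|?|] [?|?|?|?|?|?|?|];
    rewrite ?orbF //; case: u u' => [?|?|?|?|?|?|?|] [?|?|?|?|?|?|?|].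
move: eqA eqB; rewrite !edge_distAE // !edge_distBE // => eqA eqB; clear same.
have eqR : on_rim u = on_rim u' by rewrite (arc_on_rimE uv) (arc_on_rimE uv') eqA eqB.
rewrite !node_eqE.
case: u v uv eqA eqB eqTw eqR =>
  [s|i|i|i|i|i|j|] [s1|i1|i1|i1|i1|i1|j1|] //= uv;
case: u' v' uv' =>
  [s'|i'|i'|i'|i'|i'|j'|] [s1'|i1'|i1'|i1'|i1'|i1'|j1'|] //= uv' eqA eqB eqTw _;
  bounds.
- have eq_s : s = s' :> nat by apply: rim_edge_inj eqA eqB; lia.
  by rewrite eq_s eqxx; clear eqA eqB eqTw; lia.
all: try by clear eqTw uv uv'; lia.
all: try by clear eqTw; lia.
(* Only two edges at twins of A are left. *)
have [j0|/eqTw] := eqVneq j ord0; last by rewrite !node_eqE /=; clear eqTw; lia.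
have [j'0|/eqTw] := eqVneq j' ord0; last by rewrite !node_eqE /=; clear eqTw; lia.
by rewrite j0 j'0 eqxx /=; clear eqTw; lia.
Qed.

End GadgetRing.

Unset Implicit Arguments.

Theorem theorem1 (a b : nat) (hb : 4 <= b) (hab : b < a) :
  exists G : sgraph,
    [/\ two_connected G, metric_dim G = a & edge_metric_dim G = b].
Proof.
exists (gadget_ring (a - b) (b - 2)); split; first exact: gadget_ring_two_connected.
- apply: metric_dimE => [S /metric_lower|]; first lia.
  exists (landmarks (a - b) (b - 2)); first exact: landmarks_generate.
  apply: leq_trans (leq_imset_card _ _) _.
  by rewrite !card_sum !card_ord card_unit; lia.
- apply: edge_metric_dimE => [S /edge_metric_lower|]; first lia.
  exists (edge_landmarks (a - b) (b - 2)); first exact: edge_landmarks_generate.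
  apply: leq_trans (leq_imset_card _ _) _.
  by rewrite !card_sum !card_ord card_unit; lia.
Qed.
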